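(* Consider the stochastic Galerkin system of the two-dimensional shallow water equations $$\partial_t \widehat U+\partial_x \widehat F(\widehat U)+\partial_y \widehat G(\widehat U)=\widehat S(\widehat U,\widehat B),\qquad \widehat U=(\widehat h^\top,\widehat{q^x}^\top,\widehat{q^y}^\top)^\top\in\mathbb{R}^{3K},$$ with fluxes $$\widehat F(\widehat U)=\begin{pmatrix}\widehat{q^x}\\ \mathcal P(\widehat{q^x})\mathcal P^{-1}(\widehat h)\widehat{q^x}+\tfrac12 g\,\mathcal P(\widehat h)\widehat h\\ \mathcal P(\widehat{q^x})\mathcal P^{-1}(\widehat h)\widehat{q^y}\end{pmatrix},\qquad \widehat G(\widehat U)=\begin{pmatrix}\widehat{q^y}\\ \mathcal P(\widehat{q^y})\mathcal P^{-1}(\widehat h)\widehat{q^x}\\ \mathcal P(\widehat{q^y})\mathcal P^{-1}(\widehat h)\widehat{q^y}+\tfrac12 g\,\mathcal P(\widehat h)\widehat h\end{pmatrix}$$ and source term $\widehat S(\widehat U,\widehat B)=\big(0,\,-(g\mathcal P(\widehat h)\widehat{B_x})^\top,\,-(g\mathcal P(\widehat h)\widehat{B_y})^\top\big)^\top$. If the symmetric matrix $\mathcal P(\widehat h)$ is strictly positive definite at every point $(x,y,t)$ of the computational spatial-temporal domain, then this system is hyperbolic; that is, at every such point and for every unit vector $\boldsymbol n=(n_x,n_y)^\top\in\mathbb{R}^2$, the matrix $$n_x\frac{\partial\widehat F}{\partial\widehat U}+n_y\frac{\partial\widehat G}{\partial\widehat U}\in\mathbb{R}^{3K\times 3K}$$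 is diagonalizable over $\mathbb{R}$ (real eigenvalues and a complete set of real eigenvectors).
   Context: Let $\rho$ be a probability density on $\mathbb{R}^d$ with finite polynomial moments of all orders and let $\langle f_1,f_2\rangle_\rho=\int_{\mathbb{R}^d}f_1(s)f_2(s)\rho(s)\,ds$. Let $\Lambda\subset\mathbb{N}_0^d$ be a finite set of multi-indices with $0\in\Lambda$, $|\Lambda|=K$, and let $P_\Lambda=\mathrm{span}\{\zeta^\nu:\nu\in\Lambda\}$, of dimension $K$. Let $\phi_1,\dots,\phi_K$ be an $L^2_\rho$-orthonormal basis of $P_\Lambda$ with $\phi_1\equiv1$. Define the linear operator $\mathcal P:\mathbb{R}^K\to\mathbb{R}^{K\times K}$ by $$\mathcal P(\widehat z)=\sum_{k=1}^K\widehat z_k\mathcal M_k,\qquad (\mathcal M_k)_{\ell m}=\langle\phi_k,\phi_\ell\phi_m\rangle_\rho ,$$ so that each $\mathcal M_k$, and hence $\mathcal P(\widehat z)$, is symmetric. $\mathcal P^{-1}(\widehat z)$ denotes the matrix inverse of $\mathcal P(\widehat z)$. $g>0$ is the gravitational constant. The unknowns $\widehat h,\widehat{q^x},\widehat{q^y}$ are $\mathbb{R}^K$-valued functions of $(x,y,t)$ (the coefficient vectors in the basis $\phi_k$ of the water height and of the discharges in the $x$- and $y$-directions). $\widehat{B_x},\widehat{B_y}\in\mathbb{R}^K$ are the coefficient vectors of the $x$- and $y$-derivatives of the bottom topography $B(x,y,\xi)$ projected onto $P_\Lambda$. $\partial\widehat F/\partial\widehat U$ and $\partial\widehat G/\partial\widehat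 U$ are the $3K\times3K$ Jacobian matrices of $\widehat F,\widehat G$ with respect to $\widehat U$. *)

(* Defs.v *)
From HB Require Import structures.
From mathcomp Require Import all_boot all_order all_algebra finmap.
From mathcomp Require Import all_classical all_reals all_analysis.
Import Order.TTheory GRing.Theory Num.Theory.
Import numFieldNormedType.Exports.

Set Implicit Arguments.
Unset Strict Implicit.
Unset Printing Implicit Defensive.

Local Open Scope classical_set_scope.
Local Open Scope ring_scope.

(* Tuples, rather than ['rV[R]_d], carry the product sigma-algebra in the
   library. *)
Notation Rvec R d := (d.-tuple (measurableTypeR R)).

Section lebesgue_Rd.
Context {R : realType}.

Definition tcons d (x : measurableTypeR R * Rvec R d) : Rvec R d.+1 :=
  [tuple of x.1 :: x.2].

Lemma measurable_tcons d : measurable_fun setT (@tcons d).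
Proof. exact: measurable_cons. Qed.

Section step.
Context d (mu : {sigma_finite_measure set (Rvec R d) -> \bar R}).

Let prod_mu : {measure set (measurableTypeR R * Rvec R d)%type -> \bar R} :=
  (@lebesgue_measure R \x mu)%E.

Let mpreim A : measurable A -> measurable (@tcons d @^-1` A).
Proof. by move=> mA; rewrite -[X in measurable X]setTI; exact: measurable_tcons. Qed.

Definition lebesgue_cons : set (Rvec R d.+1) -> \bar R :=
  pushforward prod_mu (@tcons d).

Let lebesgue_cons0 : lebesgue_cons set0 = 0%E.
Proof. by rewrite /lebesgue_cons /pushforward preimage_set0 measure0. Qed.

Let lebesgue_cons_ge0 A : (0 <= lebesgue_cons A)%E.
Proof. exact: (measure_ge0 prod_mu). Qed.

Let lebesgue_cons_sigma_additive : semi_sigma_additive lebesgue_cons.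
Proof.
move=> F mF tF mUF; rewrite /lebesgue_cons /pushforward preimage_bigcup.
apply: measure_semi_sigma_additive.
- by move=> n; exact: mpreim.
- apply/trivIsetP => /= i j _ _ ij; rewrite -preimage_setI.
  by move/trivIsetP : tF => /(_ _ _ _ _ ij) ->//; rewrite preimage_set0.
- by rewrite -preimage_bigcup; exact: mpreim.
Qed.

HB.instance Definition _ := isMeasure.Build _ _ _ lebesgue_cons
  lebesgue_cons0 lebesgue_cons_ge0 lebesgue_cons_sigma_additive.

Let lebesgue_cons_sigma_finite : sigma_finite setT lebesgue_cons.
Proof.
have /sigma_finiteP[F [UF ndF mF]] := sigma_finiteT (@lebesgue_measure R).
have /sigma_finiteP[E [UE ndE mE]] := sigma_finiteT mu.
pose G (t : Rvec R d.+1) : measurableTypeR R * Rvec R d :=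
  (thead t, [tuple of behead t]).
have mG : measurable_fun setT G.
  apply/measurable_fun_pairP; split; last exact: measurable_behead.
  exact: (@measurable_tnth _ _ _ ord0).
have GK : cancel (@tcons d) G by case=> x t; congr pair; exact: val_inj.
exists (fun n => G @^-1` (F n `*` E n)).
  apply/esym/seteqP; split=> // t _.
  have : setT (G t).1 by [].
  rewrite UF => -[i _ Fi].
  have : setT (G t).2 by [].
  rewrite UE => -[j _ Ej].
  exists (maxn i j) => //; split.
    by move: Fi; exact/subsetPset/ndF/leq_maxl.
  by move: Ej; exact/subsetPset/ndE/leq_maxr.
move=> n; have [mFn Foo] := mF n; have [mEn Eoo] := mE n; split.
  by rewrite -[X in measurable X]setTI; apply: mG => //; exact: measurableX.
rewrite /lebesgue_cons /pushforward [X in prod_mu X](_ : _ = F n `*` E n).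
  rewrite /prod_mu/= product_measure1E//.
  by rewrite lte_mul_pinfty// ge0_fin_numE.
by rewrite -comp_preimage (_ : G \o _ = id) ?preimage_id//; exact/funext.
Qed.

HB.instance Definition _ := Measure_isSigmaFinite.Build _ _ _ lebesgue_cons
  lebesgue_cons_sigma_finite.

End step.

(* Characterized by its values on boxes, see [lebesgue_Rd_box]. *)
Fixpoint lebesgue_Rd d : {sigma_finite_measure set (Rvec R d) -> \bar R} :=
  if d is d'.+1 then lebesgue_cons (lebesgue_Rd d')
  else \d_([tuple] : Rvec R 0).

Lemma lebesgue_Rd_box d (A : 'I_d -> set (measurableTypeR R)) :
  (forall i, measurable (A i)) ->
  lebesgue_Rd d [set t | forall i, A i (tnth t i)] =
  (\prod_(i < d) lebesgue_measure (A i))%E.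
Proof.
elim: d A => [|d IH] A mA.
  rewrite big_ord0 /= (_ : [set _ | _] = setT) ?diracT//.
  by apply/seteqP; split=> // t _ [].
rewrite big_ord_recl -IH//= /lebesgue_cons /pushforward.
rewrite -product_measure1E//.
  congr (_ _); apply/seteqP; split=> -[x t] /=.
    move=> h; split=> [|i]; first by have := h ord0; rewrite tnth0.
    by have := h (lift ord0 i); rewrite tnthS.
  case=> h0 h i; have [->|] := eqVneq i ord0; first by rewrite tnth0.
  by case: (unliftP ord0 i) => [j ->|->]; rewrite ?eqxx// tnthS.
rewrite (_ : [set _ | _] = \bigcap_(i in [set: 'I_d])
    ((fun t => tnth t i) @^-1` A (lift ord0 i))).
  apply: fin_bigcap_measurable => // i _.
  by rewrite -[X in measurable X]setTI; exact: measurable_tnth.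
by apply/seteqP; split=> t /= h i; [move=> _; exact: h|exact: h].
Qed.

End lebesgue_Rd.

Section polynomial_space.
Context {R : realType} {d : nat}.
Implicit Types (rho : Rvec R d -> R) (Lambda : {fset {ffun 'I_d -> nat}}).

Definition monomial (nu : {ffun 'I_d -> nat}) : Rvec R d -> R :=
  fun s => \prod_(i < d) tnth s i ^+ nu i.

Definition probability_density rho :=
  [/\ measurable_fun setT rho, forall s, 0 <= rho s &
      (\int[lebesgue_Rd d]_s (rho s)%:E = 1)%E].

Definition finite_moments rho := forall nu : {ffun 'I_d -> nat},
  (lebesgue_Rd d).-integrable setT (fun s => (monomial nu s * rho s)%:E).

Definition inner rho (f1 f2 : Rvec R d -> R) : R :=
  \int[lebesgue_Rd d]_s (f1 s * f2 s * rho s).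

Definition lin_span (I : Type) (r : seq I) (f : I -> Rvec R d -> R) :
    set (Rvec R d -> R) :=
  [set h | exists c : I -> R, h = fun s => \sum_(i <- r) c i * f i s].

Definition poly_space Lambda : set (Rvec R d -> R) :=
  lin_span Lambda monomial.

(* Linear independence of [phi] follows from orthonormality. *)
Definition orthonormal_basis rho (V : set (Rvec R d -> R)) K
    (phi : 'I_K -> Rvec R d -> R) :=
  lin_span (enum 'I_K) phi = V /\
  forall k l, inner rho (phi k) (phi l) = (k == l)%:R.

Definition calM rho K (phi : 'I_K -> Rvec R d -> R) (k : 'I_K) : 'M[R]_K :=
  \matrix_(l, m) inner rho (phi k) (fun s => phi l s * phi m s).

Definition calP rho K (phi : 'I_K -> Rvec R d -> R) (z : 'cV[R]_K) : 'M[R]_K :=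
  \sum_(k < K) z k 0 *: calM rho phi k.

Definition proj_coef rho K (phi : 'I_K -> Rvec R d -> R)
    (f : Rvec R d -> R) : 'cV[R]_K :=
  \col_k inner rho f (phi k).

End polynomial_space.

Definition posdefmx (R : realType) n (A : 'M[R]_n) :=
  A^T = A /\ forall v : 'cV[R]_n, v != 0 -> 0 < (v^T *m A *m v) 0 0.

(* The library's [jacobian] acts on row vectors and is the transpose of this. *)
Definition jacobian_col (R : realType) m n (f : 'cV[R]_m -> 'cV[R]_n)
    (u : 'cV[R]_m) : 'M[R]_(n, m) :=
  \matrix_(i, j) ('D_(delta_mx j 0) f u) i 0.

Lemma diff_jacobian_col (R : realType) m n (f : 'cV[R]_m -> 'cV[R]_n) u v :
  differentiable f u -> 'd f u v = jacobian_col f u *m v.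
Proof.
move=> df; rewrite [in LHS](matrix_sum_delta v) linear_sum; apply/colP => i.
rewrite summxE mxE; apply: eq_bigr => j _.
by rewrite big_ord1 linearZ mxE mxE deriveE// mulrC.
Qed.

(* The system  d_t U + d_x F(U) + d_y G(U) = S(x, y, t, U). *)
Record balance_law (R : realType) n := BalanceLaw {
  flux_x : 'cV[R]_n -> 'cV[R]_n;
  flux_y : 'cV[R]_n -> 'cV[R]_n;
  source : R * R * R -> 'cV[R]_n -> 'cV[R]_n }.

(* Differentiability of the fluxes is part of the definition because
   [jacobian_col] is a total function with junk values. *)
Definition hyperbolic_at (R : realType) n (L : balance_law R n)
    (u : 'cV[R]_n) :=
  [/\ differentiable (flux_x L) u, differentiable (flux_y L) u &
      forall nx ny : R, nx ^+ 2 + ny ^+ 2 = 1 ->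
        diagonalizable (nx *: jacobian_col (flux_x L) u +
                        ny *: jacobian_col (flux_y L) u)].

(* [U] gives the unknowns as functions of (x, y, t). *)
Definition hyperbolic_on (R : realType) n (L : balance_law R n)
    (D : set (R * R * R)) (U : R * R * R -> 'cV[R]_n) :=
  forall p, D p -> hyperbolic_at L (U p).

Section shallow_water.
Context {R : realType} {d K : nat}.
Variables (rho : Rvec R d -> R) (phi : 'I_K -> Rvec R d -> R).
Variables (g : R) (B : R -> R -> Rvec R d -> R).
Let P := calP rho phi.

Definition swe_state (h qx qy : 'cV[R]_K) : 'cV[R]_(K + (K + K)) :=
  col_mx h (col_mx qx qy).

Definition swe_h (U : 'cV[R]_(K + (K + K))) : 'cV[R]_K := usubmx U.
Definition swe_qx (U : 'cV[R]_(K + (K + K))) : 'cV[R]_K := usubmx (dsubmx U).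
Definition swe_qy (U : 'cV[R]_(K + (K + K))) : 'cV[R]_K := dsubmx (dsubmx U).

Definition swe_flux_x (U : 'cV[R]_(K + (K + K))) : 'cV[R]_(K + (K + K)) :=
  let h := swe_h U in let qx := swe_qx U in let qy := swe_qy U in
  swe_state qx
            (P qx *m invmx (P h) *m qx + (2^-1 * g) *: (P h *m h))
            (P qx *m invmx (P h) *m qy).

Definition swe_flux_y (U : 'cV[R]_(K + (K + K))) : 'cV[R]_(K + (K + K)) :=
  let h := swe_h U in let qx := swe_qx U in let qy := swe_qy U in
  swe_state qy
            (P qy *m invmx (P h) *m qx)
            (P qy *m invmx (P h) *m qy + (2^-1 * g) *: (P h *m h)).

(* [derive1] and the integral in [inner] are total; no regularity of [B] is
   needed for these to be defined. *)
Definition bottom_dx (x y : R) : 'cV[R]_K :=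
  proj_coef rho phi (fun s => derive1 (fun x' => B x' y s) x).

Definition bottom_dy (x y : R) : 'cV[R]_K :=
  proj_coef rho phi (fun s => derive1 (fun y' => B x y' s) y).

Definition swe_source (p : R * R * R) (U : 'cV[R]_(K + (K + K))) :
    'cV[R]_(K + (K + K)) :=
  let x := p.1.1 in let y := p.1.2 in
  swe_state 0
            (- (g *: (P (swe_h U) *m bottom_dx x y)))
            (- (g *: (P (swe_h U) *m bottom_dy x y))).

Definition swe_sg : balance_law R (K + (K + K)) :=
  BalanceLaw swe_flux_x swe_flux_y swe_source.

End shallow_water.

(* Main.v *)
(* Put H = P(h), u = H^-1 qx, v = H^-1 qy.  The triple products defining P are
   totally symmetric, so P(y) z = P(z) y and H du = dqx - P(u) dh (likewise for
   v).  In the unknowns dh, a = dqx - P(u) dh, b = dqy - P(v) dh, the matrix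
   nx F' + ny G' becomes

     [ P(nx u + ny v)   nx I       ny I     ]
     [ nx g H           N H^-1     0        ]     N = P(nx qx + ny qy),
     [ ny g H           0          N H^-1   ]

   and multiplying it on the right by the positive definite matrix
   T = diag(I, g H, g H) makes it symmetric.  A matrix A with A T symmetric and
   T positive definite is self-adjoint for the inner product v T w^T, hence
   diagonalizable over R: the roots of its minimal polynomial are real, and a
   nilpotent polynomial in A vanishes. *)

Require Import Defs.
From HB Require Import structures.
From mathcomp Require Import all_boot all_order all_algebra finmap.
From mathcomp Require Import all_classical all_reals all_analysis.
From mathcomp Require Import perm complex.
Import Order.TTheory GRing.Theory Num.Theory.
Import numFieldNormedType.Exports.

Set Implicit Arguments.
Unset Strict Implicit.
Unset Printing Implicit Defensive.

Local Open Scope classical_set_scope.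
Local Open Scope ring_scope.

(** * Matrices symmetrized by a positive definite matrix *)

Lemma posdefmx_row_gt0 (R : realType) n (T : 'M[R]_n) (v : 'rV[R]_n) :
  posdefmx T -> v != 0 -> 0 < (v *m T *m v^T) 0 0.
Proof.
by move=> [_ Tpos] v0; have := Tpos v^T; rewrite trmxK trmx_eq0; exact.
Qed.

Lemma posdefmx_unit (R : realType) n (T : 'M[R]_n) :
  posdefmx T -> T \in unitmx.
Proof.
move=> Tpos; rewrite -row_free_unit; apply/inj_row_free => v vT0.
apply/eqP; apply/negP => /negP /(posdefmx_row_gt0 Tpos).
by rewrite vT0 mul0mx mxE ltxx.
Qed.

(** Turns a positive definite symmetrizer found in convenient unknowns into one for the original
    unknowns. *)
Lemma posdefmx_congr (R : realType) n (L T : 'M[R]_n) :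
  L \in unitmx -> posdefmx T -> posdefmx (L *m T *m L^T).
Proof.
move=> Lu [TT Tpos]; split=> [|v v0].
  by rewrite !trmx_mul trmxK TT mulmxA.
have := Tpos (L^T *m v); rewrite trmx_mul trmxK !mulmxA; apply.
apply: contra v0 => /eqP /(congr1 (mulmx (invmx L^T))).
by rewrite mulmxA mulVmx ?unitmx_tr// mul1mx mulmx0 => ->.
Qed.

Lemma posdefmx1 (R : realType) n : posdefmx (1%:M : 'M[R]_n).
Proof.
split=> [|v v0]; first by rewrite trmx1.
rewrite mulmx1 mxE; under eq_bigr do rewrite mxE -expr2.
rewrite lt0r sumr_ge0 ?andbT => [|i _]; last exact: sqr_ge0.
apply: contra v0; rewrite psumr_eq0 => [/allP v0|i _]; last exact: sqr_ge0.
apply/eqP/colP => i; rewrite mxE.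
by apply/eqP; have := v0 i; rewrite mem_index_enum sqrf_eq0; exact.
Qed.

Lemma posdefmxZ (R : realType) n (c : R) (T : 'M[R]_n) :
  0 < c -> posdefmx T -> posdefmx (c *: T).
Proof.
move=> c0 [TT Tpos]; split=> [|v v0]; first by rewrite linearZ/= TT.
by rewrite -scalemxAr -scalemxAl mxE mulr_gt0// Tpos.
Qed.

Lemma posdefmx_block (R : realType) m n (S : 'M[R]_m) (T : 'M[R]_n) :
  posdefmx S -> posdefmx T -> posdefmx (block_mx S 0 0 T).
Proof.
move=> [SS Spos] [TT Tpos]; split=> [|v].
  by rewrite tr_block_mx SS TT !trmx0.
rewrite -[v]vsubmxK; set a := usubmx v; set b := dsubmx v.
rewrite tr_col_mx mul_row_block !mulmx0 addr0 add0r mul_row_col mxE.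
have [->|a0] := eqVneq a 0.
  have [->|b0 _] := eqVneq b 0; first by rewrite col_mx0 eqxx.
  by rewrite mulmx0 mxE add0r Tpos.
move=> _; apply: ltr_wpDr; last exact: Spos.
have [->|b0] := eqVneq b 0; first by rewrite mulmx0 mxE.
exact/ltW/Tpos.
Qed.

(* [(A *m T)^T = A *m T] says that [A] is self-adjoint for the inner product
   [v *m T *m w^T] of row vectors. *)
Lemma horner_mx_adjoint (R : realType) n (A T : 'M[R]_n.+1) (p : {poly R}) :
  T^T = T -> (A *m T)^T = A *m T ->
  (horner_mx A p *m T)^T = horner_mx A p *m T.
Proof.
move=> TT; rewrite !trmx_mul TT => ATT.
elim/poly_ind: p => [|p c IH]; first by rewrite rmorph0 trmx0 mulmx0 mul0mx.
rewrite rmorphD rmorphM /= horner_mx_X horner_mx_C linearD/= trmx_mul.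
rewrite tr_scalar_mx mulmxDr mulmxDl scalar_mxC mulmxA ATT -mulmxA IH.
by rewrite mulmxA (comm_mx_horner p (comm_mx_refl A)).
Qed.

(** If [M *m T] is symmetric and [M * M = 0], then [M *m T *m M^T = T *m (M * M)^T = 0], so every
    row of [M] has zero [T]-norm. This applies to [N ^+ m.+1], whose square is a multiple of
    [N ^+ m.+2], and lowers the exponent one at a time. *)
Lemma symmetrizable_nilpotent (R : realType) n (N T : 'M[R]_n.+1) m :
  posdefmx T -> (N *m T)^T = N *m T -> N ^+ m.+1 = 0 -> N = 0.
Proof.
move=> Tpos NT.
have sq0 (M : 'M[R]_n.+1) : (M *m T)^T = M *m T -> M * M = 0 -> M = 0.
  move=> MT MM0; apply/row_matrixP => i; rewrite row0.
  apply/eqP; apply/negP => /negP /(posdefmx_row_gt0 Tpos).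
  rewrite rowE trmx_mul -!mulmxA (mulmxA M) -MT trmx_mul Tpos.1 -mulmxA.
  rewrite (mulmxA M^T) -trmx_mul -[M *m M]/(M * M) MM0 trmx0.
  by rewrite mul0mx !mulmx0 mxE ltxx.
elim: m => [|m IH]; first by rewrite expr1.
move=> Nm0; apply: IH; apply: sq0; last first.
  by rewrite -exprD addSnnS addnC exprD Nm0 mul0r.
have -> : N ^+ m.+1 = horner_mx N ('X ^+ m.+1).
  by rewrite rmorphXn/= horner_mx_X.
exact/horner_mx_adjoint/NT/Tpos.1.
Qed.

(* If [v = x + i y] is an eigenvector for [a + i b], comparing [x A T y^T] with
   [y A T x^T] gives [b (x T x^T + y T y^T) = 0]. *)
Lemma symmetrizable_eigenvalue_real (R : realType) n (A T : 'M[R]_n)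
    (c : R[i]) :
  posdefmx T -> (A *m T)^T = A *m T ->
  eigenvalue (map_mx (real_complex R) A) c -> complex.Im c = 0.
Proof.
move=> Tpos AT /eigenvalueP[v vA v0]; case: c vA => a b vA /=.
pose x := map_mx (@complex.Re R) v; pose y := map_mx (@complex.Im R) v.
have vE : v = map_mx (real_complex R) x + 'i%C *: map_mx (real_complex R) y.
  by apply/rowP => j; rewrite !mxE -complexE.
have vA_E : v *m map_mx (real_complex R) A =
    map_mx (real_complex R) (x *m A) + 'i%C *: map_mx (real_complex R) (y *m A).
  by rewrite {1}vE mulmxDl -scalemxAl !map_mxM.
have xA : x *m A = a *: x - b *: y.
  apply/rowP => j; move: vA_E; rewrite vA => /rowP/(_ j); rewrite !mxE.
  by case: (v 0 j) => p q /(congr1 (@complex.Re R)) /= ->;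
    rewrite mul0r mulr0 subrr addr0.
have yA : y *m A = a *: y + b *: x.
  apply/rowP => j; move: vA_E; rewrite vA => /rowP/(_ j); rewrite !mxE.
  by case: (v 0 j) => p q /(congr1 (@complex.Im R)) /= ->;
    rewrite mul0r add0r mul1r add0r.
have symT (p q : 'rV[R]_n) (M : 'M[R]_n) : M^T = M ->
    p *m M *m q^T = q *m M *m p^T.
  move=> MT; rewrite -[LHS]trmxK [X in X^T](_ : _ = q *m M *m p^T).
    by apply/matrixP => i j; rewrite !ord1 mxE.
  by rewrite !trmx_mul trmxK MT mulmxA.
have := symT x y _ AT; rewrite !mulmxA xA yA !mulmxDl !mulNmx -!scalemxAl.
(* The terms in [a] cancel because [T] is symmetric; what remains is
   [- b (y T y^T) = b (x T x^T)]. *)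
rewrite (symT y x _ Tpos.1) => /addrI /matrixP/(_ 0 0); rewrite !mxE.
pose Q (w : 'rV[R]_n) := (w *m T *m w^T) 0 0.
move=> bE0.
have bE : - (b * Q y) = b * Q x by rewrite /Q !mxE.
apply/eqP; have qp_gt0 : 0 < Q y + Q x.
  have ge0 w : 0 <= Q w.
    rewrite /Q; have [->|w0] := eqVneq w 0; first by rewrite !mul0mx mxE.
    exact/ltW/posdefmx_row_gt0.
  have [x0|x0] := eqVneq x 0.
    apply: ltr_wpDr (ge0 x) _; apply: posdefmx_row_gt0 => //.
    by apply: contra v0 => /eqP y0; rewrite vE x0 y0 !map_mx0 scaler0 addr0.
  by apply: ltr_wpDl (ge0 y) _; exact: posdefmx_row_gt0.
have : b * (Q y + Q x) = 0 by rewrite mulrDr -bE subrr.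
by move/eqP; rewrite mulf_eq0 (gt_eqF qp_gt0) orbF.
Qed.

Lemma dvdp_prod_undup (F : fieldType) (r : seq F) :
  \prod_(x <- r) ('X - x%:P) %| (\prod_(x <- undup r) ('X - x%:P)) ^+ size r.
Proof.
(* Two lists, so that the induction shrinks [s] while the squarefree product over [t] stays
   fixed. *)
have dvd (s t : seq F) : {subset s <= t} ->
    \prod_(x <- s) ('X - x%:P) %| (\prod_(x <- undup t) ('X - x%:P)) ^+ size s.
  elim: s => [|a s IH] st; first by rewrite big_nil.
  rewrite big_cons exprS dvdp_mul ?IH// => [|x xs]; last first.
    by apply: st; rewrite inE xs orbT.
  by rewrite dvdp_XsubCl root_prod_XsubC mem_undup st// mem_head.
exact: dvd.
Qed.

(** Over [R[i]] the minimal polynomial splits and its roots, being eigenvalues, are real; the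
    factorization descends to [R] because mapping coefficients is injective. *)
Lemma symmetrizable_mxminpoly_split (R : realType) n (A T : 'M[R]_n.+1) :
  posdefmx T -> (A *m T)^T = A *m T ->
  exists r : seq R, mxminpoly A = \prod_(x <- r) ('X - x%:P).
Proof.
move=> Tpos AT.
have [r rE] := closed_field_poly_normal (mxminpoly (map_mx (real_complex R) A)).
move: rE; rewrite (monicP (mxminpoly_monic _)) scale1r => rE.
exists [seq complex.Re c | c <- r].
apply: (map_poly_inj (real_complex R)); rewrite -mxminpoly_map rE.
rewrite rmorph_prod big_map; apply: eq_big_seq => -[a b] cr.
rewrite rmorphB/= map_polyX map_polyC/=.
suff -> : b = 0 by [].
apply: (symmetrizable_eigenvalue_real (c := (a +i* b)%C) Tpos AT).
by rewrite eigenvalue_root_min rE root_prod_XsubC.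
Qed.

(** Let [q] be the product of ['X - x%:P] over the distinct roots [x] of the minimal polynomial. The
    latter divides a power of [q], so [q] evaluated at [A] is nilpotent and self-adjoint, hence
    zero, and the minimal polynomial divides [q]. *)
Lemma symmetrizable_diagonalizable (R : realType) n (A T : 'M[R]_n) :
  posdefmx T -> (A *m T)^T = A *m T -> diagonalizable A.
Proof.
case: n A T => [|n] A T Tpos AT.
  by rewrite (flatmx0 A); exact: diagonalizable0.
have [r rE] := symmetrizable_mxminpoly_split Tpos AT.
apply/diagonalizableP; exists (undup r); first exact: undup_uniq.
apply: mxminpoly_min; apply: (symmetrizable_nilpotent (m := size r) Tpos).
  exact/horner_mx_adjoint/AT/Tpos.1.
rewrite -rmorphXn/= exprS rmorphM/=.
suff -> : horner_mx A ((\prod_(x <- undup r) ('X - x%:P)) ^+ size r) = 0.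
  by rewrite mulr0.
by apply/mxminpoly_minP; rewrite rE dvdp_prod_undup.
Qed.

(** * Differentials of matrix-valued maps *)

(** The first-order expansion at [x] only sees values near [x]. This allows differentiating
    identities that hold only where a matrix is invertible. *)
Lemma near_eq_is_diff (R : realType) (V W : normedModType R)
    (f g df : V -> W) (x : V) :
  {near x, f =1 g} -> is_diff x f df -> is_diff x g df.
Proof.
move=> fg [fx dfE].
have fgx : f x = g x by exact: nbhs_singleton fg.
have gE : g \o shift x = cst (g x) + 'd f x +o_ (0 : V) id.
  apply/eqaddoP => _ /posnumP[e].
  have := diff_locally fx => /eqaddoP/(_ _ (gt0 e)).
  have : \forall h \near (0 : V), f (h + x) = g (h + x).
    have : \forall y \near x, f y = g y by [].
    by rewrite (near_shift 0) subr0.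
  apply: filterS2 => h fgh; rewrite /= !fctE fgh fgx; exact.
have dg := diff_unique (diff_continuous fx) gE.
apply: DiffDef; last by rewrite dg.
by apply/diff_locallyP; rewrite dg; split => //; exact: diff_continuous.
Qed.

Lemma is_diff_unique (R : realType) (V W : normedModType R)
    (f df dg : V -> W) (x : V) :
  is_diff x f df -> is_diff x f dg -> df = dg.
Proof. by move=> [_ <-] [_ <-]. Qed.

Lemma differentiable_mx (R : realType) (V : normedModType R) m n
    (f : V -> 'M[R]_(m, n)) (x : V) :
  (forall i j, differentiable (fun y => f y i j) x) -> differentiable f x.
Proof.
move=> df.
have -> : f = \sum_(i < m) \sum_(j < n) (fun y => f y i j *: delta_mx i j).
  apply/funext => y; rewrite [LHS]matrix_sum_delta fct_sumE.
  by apply: eq_bigr => i _; rewrite fct_sumE.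
apply: differentiable_sum => i; apply: differentiable_sum => j.
exact: differentiableZl.
Qed.

Lemma differentiable_entry (R : realType) (V : normedModType R) m n
    (f : V -> 'M[R]_(m, n)) (x : V) i j :
  differentiable f x -> differentiable (fun y => f y i j) x.
Proof.
by move=> df; exact: (differentiable_comp df (differentiable_coord (f x) i j)).
Qed.

Lemma is_diff_mulmx (R : realType) (V : normedModType R) m n p
    (f df : V -> 'M[R]_(m, n)) (g dg : V -> 'M[R]_(n, p))
    (x : V) :
  is_diff x f df -> is_diff x g dg ->
  is_diff x (fun y => f y *m g y) (fun v => f x *m dg v + df v *m g x).
Proof.
move=> dfx dgx.
pose D := ('M[R]_(m, n) * 'M[R]_(n, p))%type.
(* The rule for bilinear maps asks for continuity, obtained here from the entries, which are sums of
   products of coordinates. *)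
have cont_mulmx : continuous (fun q : D => q.1 *m q.2).
  move=> q; apply/differentiable_continuous/differentiable_mx => i j.
  have -> : (fun q : D => (q.1 *m q.2) i j) =
      \sum_(k < n) ((fun q : D => q.1 i k) * (fun q : D => q.2 k j)).
    by apply/funext => r; rewrite mxE fct_sumE.
  apply: differentiable_sum => k; apply: differentiableM.
    apply: (differentiable_entry (f := fst)).
    by apply: (linear_differentiable (f := fst)) => ?; exact: cvg_fst.
  apply: (differentiable_entry (f := snd)).
  by apply: (linear_differentiable (f := snd)) => ?; exact: cvg_snd.
have dfg := is_diff_pair dfx dgx.
have dmul : is_diff (f x, g x) (fun q : D => q.1 *m q.2)
    (fun q => f x *m q.2 + q.1 *m g x).
  apply: DiffDef; first exact: (differentiable_bilin (f := @mulmx R m n p)).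
  exact: (diff_bilin (f := @mulmx R m n p)).
exact: (is_diff_comp dfg dmul).
Qed.

Lemma is_diff_linear_mx (R : realType) (V : normedModType R) m n p q
    (L : {linear 'M[R]_(m, n) -> 'M[R]_(p, q)}) (f df : V -> 'M[R]_(m, n))
    (x : V) :
  is_diff x f df -> is_diff x (fun y => L (f y)) (fun v => L (df v)).
Proof.
move=> dfx; have cL : continuous L.
  move=> A; apply/differentiable_continuous/differentiable_mx => i j.
  have -> : (fun B => L B i j) = \sum_(k < m) \sum_(l < n)
      (fun B : 'M[R]_(m, n) => B k l *: (L (delta_mx k l) i j : R)).
    apply/funext => B; rewrite fct_sumE {1}(matrix_sum_delta B).
    rewrite linear_sum summxE.
    apply: eq_bigr => k _; rewrite fct_sumE linear_sum summxE.
    by apply: eq_bigr => l _; rewrite linearZ mxE.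
  apply: differentiable_sum => k; apply: differentiable_sum => l.
  exact/differentiableZl/differentiable_coord.
have dL : is_diff (f x) L L.
  by apply: DiffDef; [exact: linear_differentiable|exact: diff_lin].
exact: (is_diff_comp dfx dL).
Qed.

Lemma is_diff_col_mx (R : realType) (V : normedModType R) m n p
    (f df : V -> 'M[R]_(m, p)) (g dg : V -> 'M[R]_(n, p)) (x : V) :
  is_diff x f df -> is_diff x g dg ->
  is_diff x (fun y => col_mx (f y) (g y)) (fun v => col_mx (df v) (dg v)).
Proof.
move=> dfx dgx.
(* Stacking becomes a sum of two left multiplications, which are linear maps. *)
have E (a : 'M[R]_(m, p)) (b : 'M[R]_(n, p)) :
    col_mx a b = mulmx (col_mx 1%:M 0) a + mulmx (col_mx 0 1%:M) b.
  by rewrite !mul_col_mx !mul1mx !mul0mx add_col_mx addr0 add0r.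
have := is_diffD (is_diff_linear_mx (mulmx (col_mx 1%:M 0)) dfx)
  (is_diff_linear_mx (mulmx (col_mx 0 1%:M)) dgx).
by congr (is_diff_def _ _ _); apply/funext => y; rewrite E.
Qed.

Lemma differentiable_prod (R : realType) (V : normedModType R) (I : Type)
    (r : seq I) (f : I -> V -> R) (x : V) :
  (forall i, differentiable (f i) x) ->
  differentiable (fun y => \prod_(i <- r) f i y) x.
Proof.
move=> df; elim: r => [|i r IH].
  by under eq_fun do rewrite big_nil; exact: differentiable_cst.
by under eq_fun do rewrite big_cons; exact: differentiableM.
Qed.

Lemma differentiable_det (R : realType) (V : normedModType R) n
    (f : V -> 'M[R]_n) (x : V) :
  (forall i j, differentiable (fun y => f y i j) x) ->
  differentiable (fun y => \det (f y)) x.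
Proof.
move=> df.
have -> : (fun y => \det (f y)) =
    \sum_(s : 'S_n) (-1) ^+ s *: (fun y => \prod_i f y i (s i)).
  by apply/funext => y; rewrite fct_sumE.
elim/big_ind : _ => [|? ? ? ?|s _]; first exact: differentiable_cst.
  exact: differentiableD.
exact/differentiableZ/differentiable_prod.
Qed.

(** Differentiability comes from the adjugate formula; the value of the differential then comes from
    differentiating [f y *m invmx (f y) = 1%:M], valid near [x] because the determinant stays
    nonzero there. *)
Lemma is_diff_invmx (R : realType) (V : normedModType R) n
    (f df : V -> 'M[R]_n) (x : V) :
  is_diff x f df -> f x \in unitmx ->
  is_diff x (fun y => invmx (f y))
    (fun v => - (invmx (f x) *m df v *m invmx (f x))).
Proof.
move=> dfx fxu.
have dent i j : differentiable (fun y => f y i j) x.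
  by apply: differentiable_entry; exact: ex_diff.
have ddet := differentiable_det dent.
have near_unit : \forall y \near x, f y \in unitmx.
  have /differentiable_continuous /cvgr_neq0 := ddet.
  rewrite -unitfE -unitmxE => /(_ fxu).
  by apply: filterS => y; rewrite unitmxE unitfE.
have dinv : differentiable (fun y => invmx (f y)) x.
  (* [invmx] returns its argument on singular matrices, so the adjugate formula is claimed only near
     [x]. *)
  have invE : {near x, (fun y => (\det (f y))^-1 *: \adj (f y)) =1
                       (fun y => invmx (f y))}.
    by apply: filterS near_unit => y fyu; rewrite /invmx fyu.
  suff dadj : differentiable (fun y => (\det (f y))^-1 *: \adj (f y)) x.
    by have [] := near_eq_is_diff invE (differentiableP dadj).
  apply: differentiable_mx => i j; under eq_fun do rewrite !mxE.
  apply: differentiableM.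
    by apply: differentiableV => //; rewrite -unitfE -unitmxE.
  apply: differentiableM; first exact: differentiable_cst.
  apply: differentiable_det => k l; under eq_fun do rewrite !mxE.
  exact: dent.
have dprod := is_diff_mulmx dfx (differentiableP dinv).
have d1 : is_diff x (cst 1%:M)
    (fun v => f x *m 'd (fun y => invmx (f y)) x v + df v *m invmx (f x)).
  apply: (near_eq_is_diff _ dprod).
  by apply: filterS near_unit => y fyu; rewrite mulmxV.
apply: DiffDef => //; apply/funext => v.
have /(congr1 (@^~ v)) /= := is_diff_unique (is_diff_cst _ x) d1.
rewrite -[LHS]/(0 : 'M[R]_n).
move/(congr1 (mulmx (invmx (f x)))); rewrite mulmx0 mulmxDr mulKmx// mulmxA.
by move/esym/eqP; rewrite addr_eq0 => /eqP.
Qed.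

(** * The shallow water fluxes *)

Lemma eq_mulmx_col (R : pzSemiRingType) m n (A B : 'M[R]_(m, n)) :
  (forall v : 'cV[R]_n, A *m v = B *m v) -> A = B.
Proof.
move=> AB; apply/matrixP => i j.
by have /colP/(_ i) := AB (delta_mx j 0); rewrite -!colE !mxE.
Qed.

(** * Symmetry of the triple products, and derivatives of the flux terms *)

Section galerkin_product.
Context {R : realType} {d K : nat}.
Variables (rho : Rvec R d -> R) (phi : 'I_K -> Rvec R d -> R).

Lemma calP_is_linear : linear (calP rho phi).
Proof.
move=> c y z; rewrite /calP scaler_sumr -big_split/=; apply: eq_bigr => k _.
by rewrite !mxE scalerDl scalerA.
Qed.

HB.instance Definition _ := GRing.isLinear.Build R 'cV[R]_K 'M[R]_K _
  (calP rho phi) calP_is_linear.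

Lemma calP_sym z : (calP rho phi z)^T = calP rho phi z.
Proof.
rewrite /calP linear_sum; apply: eq_bigr => k _; rewrite linearZ/=.
congr (_ *: _); apply/matrixP => l m; rewrite !mxE; congr (inner _ _ _).
by apply/funext => s; rewrite mulrC.
Qed.

(** Both sides expand into double sums of triple products, whose integrand is invariant under
    permuting indices. Thus [calP dh *m u] can be read as a matrix acting on [dh]. *)
Lemma calPC y z : calP rho phi y *m z = calP rho phi z *m y.
Proof.
have E (a b : 'cV[R]_K) l : (calP rho phi a *m b) l 0 =
    \sum_k \sum_m a k 0 * b m 0 * calM rho phi k l m.
  rewrite mxE exchange_big/=; apply: eq_bigr => m _.
  rewrite /calP summxE mulr_suml; apply: eq_bigr => k _.
  by rewrite mxE mulrAC.
apply/colP => l; rewrite !E exchange_big/=; apply: eq_bigr => m _.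
apply: eq_bigr => k _; rewrite (mulrC (y k 0)) !mxE; congr (_ * _).
apply: eq_Rintegral => s _.
by rewrite mulrCA (mulrCA (phi m s)) (mulrC (phi k s)).
Qed.

Lemma is_diff_calP (V : normedModType R) (f df : V -> 'cV[R]_K) x :
  is_diff x f df ->
  is_diff x (fun y => calP rho phi (f y)) (fun v => calP rho phi (df v)).
Proof. exact: (is_diff_linear_mx (calP rho phi)). Qed.

(* Since [calP q *m invmx (calP h) *m r = calP q *m u] where [calP h *m u = r],
   the derivative follows from [calP h *m du = dr - calP dh *m u]. *)
Lemma is_diff_advection (V : normedModType R) (h dh q dq r dr : V -> 'cV[R]_K)
    (x : V) (Hi := invmx (calP rho phi (h x))) :
  calP rho phi (h x) \in unitmx ->
  is_diff x h dh -> is_diff x q dq -> is_diff x r dr ->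
  is_diff x
    (fun y => calP rho phi (q y) *m invmx (calP rho phi (h y)) *m r y)
    (fun v => calP rho phi (Hi *m r x) *m dq v +
       calP rho phi (q x) *m Hi *m (dr v - calP rho phi (Hi *m r x) *m dh v)).
Proof.
move=> hu dhx dqx drx.
have dF := is_diff_mulmx (is_diff_mulmx (is_diff_calP dqx)
  (is_diff_invmx (is_diff_calP dhx) hu)) drx.
apply: (is_diff_eq dF); apply/funext => v /=; rewrite -/Hi.
rewrite mulmxDl addrA addrC; congr (_ + _).
  by rewrite -mulmxA calPC.
rewrite mulmxBr mulmxN mulNmx; congr (_ - _).
by rewrite -!mulmxA (calPC (dh v)).
Qed.

(** By [calPC] the two terms of the product rule coincide, which cancels the factor [2^-1]. *)
Lemma is_diff_pressure (V : normedModType R) (g : R) (h dh : V -> 'cV[R]_K)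
    (x : V) :
  is_diff x h dh ->
  is_diff x (fun y => (2^-1 * g) *: (calP rho phi (h y) *m h y))
    (fun v => (g *: calP rho phi (h x)) *m dh v).
Proof.
move=> dhx.
have dF := is_diffZ (2^-1 * g) (is_diff_mulmx (is_diff_calP dhx) dhx).
apply: (is_diff_eq dF); apply/funext => v.
rewrite /= !fctE (calPC (dh v)) -mulr2n -[_ *m _ *+ 2]scaler_nat scalerA.
by rewrite -scalemxAl mulrAC mulVf ?mul1r// pnatr_eq0.
Qed.

End galerkin_product.

(** * Flux Jacobians and their common symmetrizer *)

Section shallow_water.
Context {R : realType} {d K : nat}.
Variables (rho : Rvec R d -> R) (phi : 'I_K -> Rvec R d -> R) (g : R).
Let P := calP rho phi.

Lemma is_diff_swe_state (V : normedModType R)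
    (h dh qx dqx qy dqy : V -> 'cV[R]_K) x :
  is_diff x h dh -> is_diff x qx dqx -> is_diff x qy dqy ->
  is_diff x (fun y => swe_state (h y) (qx y) (qy y))
    (fun v => swe_state (dh v) (dqx v) (dqy v)).
Proof. by move=> ? ? ?; do 2 apply: is_diff_col_mx. Qed.

Lemma is_diff_swe_h U : is_diff U (@swe_h R K) (@swe_h R K).
Proof. exact: (is_diff_linear_mx usubmx (is_diff_id U)). Qed.

Lemma is_diff_swe_qx U : is_diff U (@swe_qx R K) (@swe_qx R K).
Proof.
exact: (is_diff_linear_mx usubmx (is_diff_linear_mx dsubmx (is_diff_id U))).
Qed.

Lemma is_diff_swe_qy U : is_diff U (@swe_qy R K) (@swe_qy R K).
Proof.
exact: (is_diff_linear_mx dsubmx (is_diff_linear_mx dsubmx (is_diff_id U))).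
Qed.

Lemma is_diff_swe_flux_x h qx qy (Hi := invmx (P h)) :
  P h \in unitmx ->
  is_diff (swe_state h qx qy) (swe_flux_x rho phi g)
    (fun v => swe_state (swe_qx v)
      (P (Hi *m qx) *m swe_qx v +
       P qx *m Hi *m (swe_qx v - P (Hi *m qx) *m swe_h v) +
       (g *: P h) *m swe_h v)
      (P (Hi *m qy) *m swe_qx v +
       P qx *m Hi *m (swe_qy v - P (Hi *m qy) *m swe_h v))).
Proof.
move=> hu; set U := swe_state h qx qy.
have hE : swe_h U = h by rewrite /swe_h col_mxKu.
have qxE : swe_qx U = qx by rewrite /swe_qx col_mxKd col_mxKu.
have qyE : swe_qy U = qy by rewrite /swe_qy !col_mxKd.
have dh := is_diff_swe_h U; have dqx := is_diff_swe_qx U.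
have dqy := is_diff_swe_qy U.
have hu' : calP rho phi (swe_h U) \in unitmx by rewrite hE.
have := is_diff_swe_state dqx (is_diffD (is_diff_advection hu' dh dqx dqx)
  (is_diff_pressure rho phi g dh)) (is_diff_advection hu' dh dqx dqy).
by rewrite hE qxE qyE.
Qed.

Lemma is_diff_swe_flux_y h qx qy (Hi := invmx (P h)) :
  P h \in unitmx ->
  is_diff (swe_state h qx qy) (swe_flux_y rho phi g)
    (fun v => swe_state (swe_qy v)
      (P (Hi *m qx) *m swe_qy v +
       P qy *m Hi *m (swe_qx v - P (Hi *m qx) *m swe_h v))
      (P (Hi *m qy) *m swe_qy v +
       P qy *m Hi *m (swe_qy v - P (Hi *m qy) *m swe_h v) +
       (g *: P h) *m swe_h v)).
Proof.
move=> hu; set U := swe_state h qx qy.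
have hE : swe_h U = h by rewrite /swe_h col_mxKu.
have qxE : swe_qx U = qx by rewrite /swe_qx col_mxKd col_mxKu.
have qyE : swe_qy U = qy by rewrite /swe_qy !col_mxKd.
have dh := is_diff_swe_h U; have dqx := is_diff_swe_qx U.
have dqy := is_diff_swe_qy U.
have hu' : calP rho phi (swe_h U) \in unitmx by rewrite hE.
have := is_diff_swe_state dqy (is_diff_advection hu' dh dqy dqx)
  (is_diffD (is_diff_advection hu' dh dqy dqy) (is_diff_pressure rho phi g dh)).
by rewrite hE qxE qyE.
Qed.

(* Change of unknowns [(dh, a, b)] to [(dh, dqx, dqy)], where
   [a = dqx - P u dh] and [b = dqy - P v dh]. *)
Definition swe_basis (u v : 'cV[R]_K) : 'M[R]_(K + (K + K)) :=
  block_mx 1%:M 0 (col_mx (P u) (P v)) 1%:M.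

(* The flux Jacobians in the unknowns [(dh, a, b)]; [w] is the velocity along
   the discharge [q], and the direction is [(nx, ny)]. *)
Definition swe_reduced (nx ny : R) (h q w : 'cV[R]_K) : 'M[R]_(K + (K + K)) :=
  block_mx (P w) (row_mx nx%:M ny%:M)
    (col_mx (nx *: (g *: P h)) (ny *: (g *: P h)))
    (block_mx (P q *m invmx (P h)) 0 0 (P q *m invmx (P h))).

Definition swe_scaling (h : 'cV[R]_K) : 'M[R]_(K + (K + K)) :=
  block_mx 1%:M 0 0 (block_mx (g *: P h) 0 0 (g *: P h)).

Lemma swe_basis_unit u v : swe_basis u v \in unitmx.
Proof. by rewrite unitmxE det_lblock !det1 mulr1 unitr1. Qed.

(** The scaling turns the first-row blocks [nx%:M] and [ny%:M] into multiples of [g *: P h] that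
    match the first column, and the blocks [P q *m invmx (P h)] into [g *: P q]; values of [P] are
    symmetric. *)
Lemma swe_reduced_sym nx ny h q w :
  P h \in unitmx ->
  (swe_reduced nx ny h q w *m swe_scaling h)^T =
  swe_reduced nx ny h q w *m swe_scaling h.
Proof.
move=> hu; rewrite /swe_reduced /swe_scaling.
rewrite !mulmx_block !mulmx1 !mulmx0 !mul0mx !addr0 !add0r mul_row_block.
rewrite !mulmx0 !addr0 !add0r !mul_scalar_mx -!scalemxAr mulmxKV//.
by rewrite !tr_block_mx tr_row_mx tr_col_mx !trmx0 !linearZ/= /P !calP_sym
  !scalerA !(mulrC g).
Qed.

Lemma swe_jacobian_x h qx qy (u := invmx (P h) *m qx) (v := invmx (P h) *m qy) :
  P h \in unitmx ->
  jacobian_col (swe_flux_x rho phi g) (swe_state h qx qy) *m swe_basis u v =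
  swe_basis u v *m swe_reduced 1 0 h qx u.
Proof.
move=> hu; apply: eq_mulmx_col => z.
have [df dfE] := is_diff_swe_flux_x qx qy hu.
rewrite -!mulmxA -diff_jacobian_col// dfE -/u -/v.
rewrite -[z]vsubmxK -[dsubmx z]vsubmxK.
move: (usubmx z) (usubmx (dsubmx z)) (dsubmx (dsubmx z)) => a b c {z}.
rewrite /swe_basis /swe_reduced !mul_block_col !mul_col_mx !mul1mx !mul0mx.
rewrite !addr0 !add_col_mx.
rewrite /swe_h /swe_qx /swe_qy !(col_mxKu, col_mxKd).
have addKx (x y : 'cV[R]_K) : x + y - x = y by rewrite addrAC subrr add0r.
(* In the new unknowns [dqx = P u *m a + b] and [dqy = P v *m a + c], so the differences in the
   differential collapse to [b] and [c]. *)
rewrite !addKx !mul_row_col !mul_scalar_mx !scale1r !scale0r !mul0mx.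
by rewrite !(addr0, add0r) -(addrA (P u *m _)) (addrC (_ *m b)).
Qed.

(** The basis is the one used for the x-flux, so both Jacobians share one symmetrizer. *)
Lemma swe_jacobian_y h qx qy (u := invmx (P h) *m qx) (v := invmx (P h) *m qy) :
  P h \in unitmx ->
  jacobian_col (swe_flux_y rho phi g) (swe_state h qx qy) *m swe_basis u v =
  swe_basis u v *m swe_reduced 0 1 h qy v.
Proof.
move=> hu; apply: eq_mulmx_col => z.
have [df dfE] := is_diff_swe_flux_y qx qy hu.
rewrite -!mulmxA -diff_jacobian_col// dfE -/u -/v.
rewrite -[z]vsubmxK -[dsubmx z]vsubmxK.
move: (usubmx z) (usubmx (dsubmx z)) (dsubmx (dsubmx z)) => a b c {z}.
rewrite /swe_basis /swe_reduced !mul_block_col !mul_col_mx !mul1mx !mul0mx.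
rewrite !addr0 !add_col_mx.
rewrite /swe_h /swe_qx /swe_qy !(col_mxKu, col_mxKd).
have addKx (x y : 'cV[R]_K) : x + y - x = y by rewrite addrAC subrr add0r.
rewrite !addKx !mul_row_col !mul_scalar_mx !scale1r !scale0r !mul0mx.
by rewrite !(addr0, add0r) -(addrA (P v *m _)) (addrC (_ *m c)).
Qed.

Lemma swe_sg_hyperbolic_at (B : R -> R -> Rvec R d -> R) h qx qy :
  0 < g -> posdefmx (P h) ->
  hyperbolic_at (swe_sg rho phi g B) (swe_state h qx qy).
Proof.
move=> g0 hpos; have hu := posdefmx_unit hpos.
split.
- by have [] := is_diff_swe_flux_x qx qy hu.
- by have [] := is_diff_swe_flux_y qx qy hu.
move=> nx ny _.
pose L := swe_basis (invmx (P h) *m qx) (invmx (P h) *m qy).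
(* From [J *m L = L *m A], the product of [J] with the transported symmetrizer is
   [L *m (A *m swe_scaling h) *m L^T], a congruence of a symmetric matrix. *)
have symT J A : J *m L = L *m A ->
    (A *m swe_scaling h)^T = A *m swe_scaling h ->
    (J *m (L *m swe_scaling h *m L^T))^T = J *m (L *m swe_scaling h *m L^T).
  move=> JL AS; rewrite !mulmxA JL -(mulmxA L A) trmx_mul trmxK trmx_mul AS.
  by rewrite !mulmxA.
(* For a fixed [T], being symmetrized by [T] is a linear condition, so each flux can be treated
   separately. *)
have combT (X Y T : 'M[R]_(K + (K + K))) :
    (X *m T)^T = X *m T -> (Y *m T)^T = Y *m T ->
    ((nx *: X + ny *: Y) *m T)^T = (nx *: X + ny *: Y) *m T.
  by move=> XT YT; rewrite mulmxDl -!scalemxAl linearD/= !linearZ/= XT YT.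
apply: (symmetrizable_diagonalizable (T := L *m swe_scaling h *m L^T)).
  apply: posdefmx_congr; first exact: swe_basis_unit.
  apply: posdefmx_block; first exact: posdefmx1.
  by apply: posdefmx_block; exact: posdefmxZ.
apply: combT.
  exact: symT (swe_jacobian_x _ _ hu) (swe_reduced_sym _ _ _ _ hu).
exact: symT (swe_jacobian_y _ _ hu) (swe_reduced_sym _ _ _ _ hu).
Qed.

End shallow_water.

Theorem theorem3p1 (R : realType) (d : nat)
    (rho : Rvec R d -> R)
    (hrho : probability_density rho) (hmom : finite_moments rho)
    (Lambda : {fset {ffun 'I_d -> nat}}) (K : nat)
    (hLambda0 : [ffun=> 0%N] \in Lambda) (hK : #|` Lambda| = K)
    (phi : 'I_K -> Rvec R d -> R)
    (hphi : orthonormal_basis rho (poly_space Lambda) phi)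
    (hphi1 : forall k : 'I_K, k = 0%N :> nat -> phi k = (fun=> 1))
    (g : R) (hg : 0 < g) (B : R -> R -> Rvec R d -> R)
    (D : set (R * R * R)) (h qx qy : R * R * R -> 'cV[R]_K)
    (hpos : forall p, D p -> posdefmx (calP rho phi (h p))) :
  hyperbolic_on (swe_sg rho phi g B) D
    (fun p => swe_state (h p) (qx p) (qy p)).
Proof.
by move=> p Dp; exact: swe_sg_hyperbolic_at hg (hpos p Dp).
Qed.
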